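(* Let $A$ be a real $m\times n$ matrix and $B$ a real $n\times\rho$ matrix, let $\Theta^{(\kappa)}=\{\Theta^{(\kappa)}_1,\ldots,\Theta^{(\kappa)}_k\}$ be a partition of $\{1,\ldots,n\}$ with $|\Theta^{(\kappa)}|=k$, let $p=(p_\ell)_{\ell=1}^k$ be a sampling probability on it, and let $c\ge 1$ be an integer. Then the estimator $$\hat S=\frac1c\sum_{i=1}^c\frac1{p_{r_i}}A_{(,\Theta^{(\kappa)}_{r_i})}B_{(\Theta^{(\kappa)}_{r_i},)},$$ where $r_1,\ldots,r_c$ are independent samples from $\{1,\ldots,k\}$ drawn according to $p$, is an unbiased estimator of $AB$, i.e. $\mathbb{E}_p[\hat S]=AB$.
   Context: A partition of $\{1,\ldots,n\}$ is into nonempty disjoint blocks $\Theta^{(\kappa)}_\ell$ of indices. A sampling probability on a partition with $k$ blocks is a vector $p=(p_\ell)_{\ell=1}^k$ with all $p_\ell>0$ and $\sum_{\ell=1}^k p_\ell=1$; index $\ell$ (equivalently block $\Theta^{(\kappa)}_\ell$) is drawn with probability $p_\ell$. For a block $\Theta^{(\kappa)}_\ell$, $A_{(,\Theta^{(\kappa)}_\ell)}$ is the $m\times|\Theta^{(\kappa)}_\ell|$ matrix formed by the columns of $A$ with indices in $\Theta^{(\kappa)}_\ell$, and $B_{(\Theta^{(\kappa)}_\ell,)}$ is the $|\Theta^{(\kappa)}_\ell|\times\rho$ matrix formed by the rows of $B$ with indices in $\Theta^{(\kappa)}_\ell$ (same ordering of indices). $\mathbb{E}_p$ denotes expectation under $p$.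 *)

(* Defs.v *)
From HB Require Import structures.
From mathcomp Require Import all_boot all_order all_algebra.
From mathcomp Require Import all_classical all_reals all_analysis.

Set Implicit Arguments.
Unset Strict Implicit.
Unset Printing Implicit Defensive.

Import Order.TTheory GRing.Theory Num.Theory.
Local Open Scope classical_set_scope.
Local Open Scope ring_scope.

(* Injectivity makes the k blocks pairwise distinct, so that the partition
   {Theta_1, ..., Theta_k} has exactly k elements. *)
Definition block_partition (n k : nat) (Theta : 'I_k -> {set 'I_n}) : Prop :=
  injective Theta /\ finset.partition (Theta @: 'I_k)%SET [set: 'I_n]%SET.

(* enum_val lists the indices of S in increasing order, for both blocks. *)
Definition col_block (R : Type) (m n : nat) (A : 'M[R]_(m, n))
    (S : {set 'I_n}) : 'M[R]_(m, #|S|) :=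
  colsub (fun j : 'I_#|S| => enum_val j) A.

Definition row_block (R : Type) (n rho : nat) (B : 'M[R]_(n, rho))
    (S : {set 'I_n}) : 'M[R]_(#|S|, rho) :=
  rowsub (fun i : 'I_#|S| => enum_val i) B.

Definition sampling_probability (R : realType) (k : nat) (p : 'I_k -> R)
  : Prop := (forall l, 0 < p l) /\ \sum_(l < k) p l = 1.

(* Since 'I_k is finite (and carries no canonical sigma-algebra), an 'I_k-valued
   map is a random variable iff its point events are measurable. *)
Definition has_law (R : realType) (d : measure_display) (T : measurableType d)
    (P : probability T R) (k : nat) (p : 'I_k -> R) (X : T -> 'I_k) : Prop :=
  forall l, measurable (X @^-1` [set l]) /\ P (X @^-1` [set l]) = (p l)%:E.

Definition mutually_independent (R : realType) (d : measure_display)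
    (T : measurableType d) (P : probability T R) (c k : nat)
    (r : 'I_c -> T -> 'I_k) : Prop :=
  forall (J : {set 'I_c}) (E : 'I_c -> set 'I_k),
    P (\bigcap_(i in [set` J]) (r i @^-1` E i)) =
    (\prod_(i in J) P (r i @^-1` E i))%E.

Definition independent_samples (R : realType) (d : measure_display)
    (T : measurableType d) (P : probability T R) (c k : nat) (p : 'I_k -> R)
    (r : 'I_c -> T -> 'I_k) : Prop :=
  (forall i, has_law P p (r i)) /\ mutually_independent P r.

Definition block_estimator (R : realType) (m n rho k c : nat)
    (A : 'M[R]_(m, n)) (B : 'M[R]_(n, rho)) (Theta : 'I_k -> {set 'I_n})
    (p : 'I_k -> R) (s : 'I_c -> 'I_k) : 'M[R]_(m, rho) :=
  c%:R^-1 *: \sum_(i < c)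
    (p (s i))^-1 *: (col_block A (Theta (s i)) *m row_block B (Theta (s i))).

(* Entrywise expectation. It is extended-real valued because the integral is;
   equality with a real matrix includes finiteness of every entry. *)
Definition expectation_mx (R : realType) (d : measure_display)
    (T : measurableType d) (P : probability T R) (m n : nat)
    (X : T -> 'M[R]_(m, n)) : 'M[\bar R]_(m, n) :=
  \matrix_(i, j) 'E_P[fun w => X w i j]%E.

Definition unbiased_estimator (R : realType) (d : measure_display)
    (T : measurableType d) (P : probability T R) (m n : nat)
    (X : T -> 'M[R]_(m, n)) (M : 'M[R]_(m, n)) : Prop :=
  expectation_mx P X = map_mx EFin M.

(* Main.v *)
Require Import Defs.
From mathcomp Require Import all_boot all_order all_algebra.
From mathcomp Require Import all_classical all_reals all_analysis.
Import GRing.Theory Num.Theory.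
Local Open Scope ring_scope.

(** Unbiasedness combines two facts. First, the product [A *m B] is a sum of
    outer products over the inner index; grouping these terms along a partition
    of the inner indices shows that [A *m B] is the sum over all blocks of the
    block products ([sum_block_mulmx]). Second, weighting a quantity [g l] by
    [(p l)^-1] exactly cancels the probability [p l] of drawing [l]
    ([integral_importance_weight]), so that each of the [c] summands of the
    estimator already has expectation [\sum_l g l]. Linearity of the expectation
    then yields the average of [c] equal values. It applies because a function of
    a sample takes finitely many values, hence is a finite combination of
    indicators of events ([comp_sum_indic]) and therefore integrable
    ([integrable_law]). *)

(** The blocks being distinct and covering all indices exactly once, summing
    over blocks and then inside each block visits every index exactly once. *)
Lemma sum_block_mulmx {R : realType} {m n rho k : nat}
    (A : 'M[R]_(m, n)) (B : 'M[R]_(n, rho)) {Theta : 'I_k -> {set 'I_n}} :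
  block_partition Theta ->
  \sum_(l < k) col_block A (Theta l) *m row_block B (Theta l) = A *m B.
Proof.
move=> [injTheta partTheta]; apply/matrixP => a b.
rewrite summxE [RHS]mxE.
transitivity (\sum_(j in [set: 'I_n]%SET) A a j * B j b); last first.
  by apply: eq_bigl => j; rewrite inE.
rewrite (finset.set_partition_big _ partTheta) /=.
rewrite big_imset; last by move=> l1 l2 _ _; exact: injTheta.
apply: eq_bigr => l _; rewrite mxE (big_enum_val (fun j => A a j * B j b)).
by apply: eq_bigr => j _; rewrite !mxE.
Qed.

(** This decomposition reduces integrals of [f \o X] to probabilities of the
    point events of [X], with measurability required of these events alone. *)
Lemma comp_sum_indic {R : realType} {T : Type} {k : nat} (f : 'I_k -> R)
    (X : T -> 'I_k) (w : T) :
  (f (X w))%:E =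
  (\sum_(l < k) (f l)%:E * (\1_(X @^-1` [set l]) w)%:E)%E.
Proof.
rewrite (bigD1 (X w)) //= big1 => [|l lX].
  by rewrite indicE mem_set// mule1 adde0.
by rewrite indicE memNset ?mule0// => /= Xl; rewrite Xl eqxx in lX.
Qed.

Section FunctionsOfASample.
Context {R : realType} {d : measure_display} {T : measurableType d}.
Context {P : probability T R} {k : nat} {p : 'I_k -> R} {X : T -> 'I_k}.
Context (lawX : has_law P p X).

Lemma integrable_indic_law (f : 'I_k -> R) (l : 'I_k) :
  P.-integrable setT (fun w => (f l)%:E * (\1_(X @^-1` [set l]) w)%:E)%E.
Proof.
by apply: integrableZl => //; apply: integrable_indic; case: (lawX l).
Qed.

Lemma integrable_law (f : 'I_k -> R) :
  P.-integrable setT (fun w => (f (X w))%:E).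
Proof.
under eq_fun do rewrite (comp_sum_indic f X).
by apply: integrable_sum => // l _; exact: integrable_indic_law.
Qed.

Lemma integral_law (f : 'I_k -> R) :
  (\int[P]_w (f (X w))%:E = (\sum_(l < k) f l * p l)%:E)%E.
Proof.
under eq_integral do rewrite (comp_sum_indic f X).
rewrite integral_sum//; last by move=> l; exact: integrable_indic_law.
rewrite -sumEFin; apply: eq_bigr => l _; have [mX PX] := lawX l.
rewrite integralZl//; last exact: integrable_indic.
rewrite integral_indic// setIT EFinM; congr (_ * _)%E; exact: PX.
Qed.

(** Positivity of [p] is what lets the weight cancel the sampling probability:
    with [p l = 0], the term [g l] would be missing from the sum. *)
Lemma integral_importance_weight (g : 'I_k -> R) :
  (forall l, 0 < p l) ->
  (\int[P]_w ((p (X w))^-1 * g (X w))%:E = (\sum_(l < k) g l)%:E)%E.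
Proof.
move=> p_gt0; rewrite (integral_law (fun l => (p l)^-1 * g l)).
congr EFin; apply: eq_bigr => l _.
by rewrite mulrAC mulVf ?mul1r// lt0r_neq0.
Qed.

End FunctionsOfASample.

Theorem proposition2p1 (R : realType) (m n rho k c : nat)
    (A : 'M[R]_(m, n)) (B : 'M[R]_(n, rho))
    (Theta : 'I_k -> {set 'I_n}) (hTheta : block_partition Theta)
    (p : 'I_k -> R) (hp : sampling_probability p)
    (hc : (1 <= c)%N)
    (d : measure_display) (T : measurableType d) (P : probability T R)
    (r : 'I_c -> T -> 'I_k) (hr : independent_samples P p r) :
  unbiased_estimator P
    (fun w => block_estimator A B Theta p (fun i => r i w)) (A *m B).
Proof.
have [p_gt0 _] := hp; have [law_r _] := hr.
apply/matrixP => a b; rewrite [LHS]mxE [RHS]mxE -(sum_block_mulmx A B hTheta) summxE.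
pose g l := (col_block A (Theta l) *m row_block B (Theta l)) a b.
rewrite unlock.
transitivity
  (\int[P]_w (c%:R^-1%:E * \sum_(i < c) ((p (r i w))^-1 * g (r i w))%:E))%E.
  apply: eq_integral => w _; rewrite sumEFin -EFinM mxE summxE.
  by congr (_ * _)%:E; apply: eq_bigr => i _; rewrite mxE.
have int_term i :
    P.-integrable setT (fun w => ((p (r i w))^-1 * g (r i w))%:E).
  exact: (integrable_law (law_r i) (fun l => (p l)^-1 * g l)).
rewrite integralZl//; last exact: integrable_sum.
rewrite integral_sum//.
under eq_bigr => i _ do
  rewrite (integral_importance_weight (law_r i) g p_gt0).
rewrite sumEFin -EFinM sumr_const card_ord -[X in _ * X]mulr_natl.
by rewrite mulKf// pnatr_eq0 -lt0n.
Qed.
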